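(* Let $G$ be a regular Lie group with Lie algebra $\mathfrak{g}$. For all $d_1,d_2\in D$ and $X_1,X_2,Y_1,Y_2\in\mathfrak{g}$, $$\exp\left((d_1+d_2)X_1+\tfrac12(d_1+d_2)^2X_2\right)\cdot\exp\left((d_1+d_2)Y_1+\tfrac12(d_1+d_2)^2Y_2\right)=\exp\left((d_1+d_2)(X_1+Y_1)+\tfrac12(d_1+d_2)^2\left(X_2+Y_2+[X_1,Y_1]\right)\right).$$
   Context: The setting is synthetic differential geometry (SDG; intuitionistic reasoning). $\mathbb{R}$ is the line, a commutative unital $\mathbb{Q}$-algebra satisfying the general Kock–Lawvere axiom for all Weil algebras. $D=\{d\in\mathbb{R}\mid d^2=0\}$. A space $M$ is microlinear if $M^{(-)}$ sends to a limit diagram every finite diagram of infinitesimal spaces (spectra of Weil algebras) with cocone that $\mathbb{R}^{(-)}$ sends to a limit diagram. A Lie group is a group $G$ that is microlinear as a space. Its Lie algebra is $\mathfrak{g}=\{X:D\to G\mid X(0)=1\}$, an $\mathbb{R}$-module with bracket characterized by $[X,Y](d_1d_2)=X(d_1)Y(d_2)X(-d_1)Y(-d_2)$ for $d_1,d_2\in D$. $G$ is regular if for every $\varsigma:\mathbb{R}\to\mathfrak{g}$ there is a unique $\gamma:\mathbb{R}\to G$ with $\gamma(0)=1$ and $\gamma(t+d)=\gamma(t)\cdot\varsigma(t)(d)$ for all $t\in\mathbb{R}$, $d\in D$. For $X\in\mathfrak{g}$, $\exp X=\gamma(1)$, where $\gamma$ corresponds to the constant map $\varsigma=X$. *)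

(* Defs.v *)
(* Synthetic differential geometry is embedded shallowly: types play the role of
   spaces, Rocq functions the role of maps, and the constructive logic of Rocq
   the role of the internal language.  The algebraic structures of MathComp
   cannot be used for the line or for Lie groups, because they all carry a
   decidable equality, which is incompatible with the Kock-Lawvere axiom.  For
   the same reason only function extensionality and proof irrelevance are used
   below, never excluded middle or choice.

   "There is a unique x" is read with its witness, i.e. as an element of
   {x | unique P x}: unique choice is valid in the internal language. *)

From mathcomp Require Import all_boot ssralg rat.
From Stdlib Require Import Ring Ring_theory.
From Stdlib Require Import FunctionalExtensionality ProofIrrelevance.

Set Implicit Arguments.
Unset Strict Implicit.
Unset Printing Implicit Defensive.

Declare Scope line_scope.
Delimit Scope line_scope with L.
Declare Scope grp_scope.
Delimit Scope grp_scope with grp.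
Declare Scope lie_scope.
Delimit Scope lie_scope with lie.
Declare Scope D_scope.
Delimit Scope D_scope with D.

Record qalgebra : Type := QAlgebra {
  qsort :> Type;
  zero : qsort;
  one : qsort;
  add : qsort -> qsort -> qsort;
  mul : qsort -> qsort -> qsort;
  sub : qsort -> qsort -> qsort;
  opp : qsort -> qsort;
  qalgebra_ring : ring_theory zero one add mul sub opp eq;
  of_rat : rat -> qsort;
  of_rat1 : of_rat 1%R = one;
  of_ratD : forall a b : rat, of_rat (a + b)%R = add (of_rat a) (of_rat b);
  of_ratM : forall a b : rat, of_rat (a * b)%R = mul (of_rat a) (of_rat b)
}.
Arguments zero {_}.
Arguments one {_}.
Arguments add {_}.
Arguments mul {_}.
Arguments sub {_}.
Arguments opp {_}.
Arguments of_rat {_}.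
Bind Scope line_scope with qsort.

Definition pow (R : qalgebra) (x : R) (n : nat) : R := iter n (mul x) one.
Definition one_half (R : qalgebra) : R := of_rat (1 / 2%:R)%R.
Arguments one_half {_}.

Notation "0" := zero : line_scope.
Notation "1" := one : line_scope.
Notation "x + y" := (add x y) : line_scope.
Notation "x * y" := (mul x y) : line_scope.
Notation "- x" := (opp x) : line_scope.
Notation "x ^+ n" := (pow x n) : line_scope.
Notation "\sum_ ( i < n ) F" := (\big[add/zero]_(i < n) F%L) : line_scope.
Local Open Scope line_scope.

(* A Weil algebra W is R.1 (+) I, where the ideal I is free with finite basis
   (e_i)_i, e_i e_j = \sum_k (wcoef i j k) e_k, and I is nilpotent. *)
Definition ideal_mul (R : qalgebra) (m : nat) (c : 'I_m -> 'I_m -> 'I_m -> R)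
    (u v : 'I_m -> R) : 'I_m -> R :=
  fun k => \sum_(i < m) \sum_(j < m) (u i * v j * c i j k).

Record weil (R : qalgebra) : Type := Weil {
  wdim : nat;
  wcoef : 'I_wdim -> 'I_wdim -> 'I_wdim -> R;
  wcoefC : forall i j k, wcoef i j k = wcoef j i k;
  wcoefA : forall i j k l,
    \sum_(p < wdim) (wcoef i j p * wcoef p k l) =
    \sum_(p < wdim) (wcoef j k p * wcoef i p l);
  wcoef_nilp : exists N, forall (u : 'I_wdim -> R) (s : seq ('I_wdim -> R)),
    size s = N -> forall k, foldl (ideal_mul wcoef) u s k = 0
}.

(* An algebra map W -> R amounts to the images r_i of the basis elements e_i. *)
Definition Spec (R : qalgebra) (W : weil R) : Type :=
  {r : 'I_(wdim W) -> R |
    forall i j, r i * r j = \sum_(k < wdim W) (wcoef i j k * r k)}.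

(* The canonical map W -> R^(Spec W); a pair (a, b) stands for the element
   a + \sum_i (b i) e_i of W. *)
Definition weil_eval (R : qalgebra) (W : weil R)
    (w : R * ('I_(wdim W) -> R)) (r : Spec W) : R :=
  w.1 + \sum_(i < wdim W) (w.2 i * sval r i).

Definition iso (A B : Type) (f : A -> B) : Type :=
  {g : B -> A | cancel f g /\ cancel g f}.

Definition kock_lawvere (R : qalgebra) : Type :=
  forall W : weil R, iso (@weil_eval R W).

Record line : Type := Line {
  line_qalgebra :> qalgebra;
  line_kock_lawvere : kock_lawvere line_qalgebra
}.

Definition D (R : qalgebra) : Type := {d : R | d * d = 0}.
Definition D_val (R : qalgebra) (d : D R) : qsort R := sval d.
Coercion D_val : D >-> qsort.

(* A diagram is given by a finite directed multigraph (J, E), and a limit over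
   it by the families of points matching along every edge. *)
Record cocone (R : qalgebra) : Type := Cocone {
  vertex : finType;
  edge : finType;
  src : edge -> vertex;
  tgt : edge -> vertex;
  obj : vertex -> weil R;
  arrow : forall e, Spec (obj (src e)) -> Spec (obj (tgt e));
  apex : weil R;
  leg : forall j, Spec (obj j) -> Spec apex;
  leg_arrow : forall e x, leg (arrow (e := e) x) = leg x
}.

Definition matches (R : qalgebra) (C : cocone R) (M : Type)
    (g : forall j : vertex C, Spec (obj j) -> M) : Prop :=
  forall (e : edge C) (x : Spec (obj (src e))), g (tgt e) (arrow x) = g (src e) x.

Definition matching (R : qalgebra) (C : cocone R) (M : Type) : Type :=
  {g : forall j : vertex C, Spec (obj j) -> M | matches g}.

Definition restrict (R : qalgebra) (C : cocone R) (M : Type)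
    (h : Spec (apex C) -> M) : matching C M :=
  exist (@matches R C M) (fun j x => h (leg x)) (fun e x => f_equal h (leg_arrow x)).

Definition to_limit (R : qalgebra) (C : cocone R) (M : Type) : Type :=
  iso (@restrict R C M).

Definition microlinear (R : qalgebra) (M : Type) : Type :=
  forall C : cocone R, to_limit C R -> to_limit C M.

(* D(2), the pairs (d, d') with d^2 = d'^2 = d d' = 0 *)
Definition D2 (R : qalgebra) : Type :=
  {p : R * R | [/\ p.1 * p.1 = 0, p.2 * p.2 = 0 & p.1 * p.2 = 0]}.

Section Infinitesimals.
Context (R : qalgebra).
Add Ring line_ring : (qalgebra_ring R).

Lemma D_scale_subproof (a : R) (d : D R) : a * d * (a * d) = 0.
Proof.
have -> : a * d * (a * d) = a * a * (d * d) by ring.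
by rewrite (svalP d); ring.
Qed.
Definition D_scale (a : R) (d : D R) : D R :=
  exist _ (a * d) (D_scale_subproof a d).

Lemma D_opp_subproof (d : D R) : - d * - d = 0.
Proof. by rewrite -(svalP d); rewrite /D_val; ring. Qed.
Definition D_opp (d : D R) : D R := exist _ (- d) (D_opp_subproof d).

Lemma D0_subproof : 0 * 0 = 0 :> R.
Proof. ring. Qed.
Definition D0 : D R := exist _ 0 D0_subproof.

Lemma D2_left_subproof (d : D R) :
  [/\ (d : R) * d = 0, 0 * 0 = 0 :> R & d * 0 = 0].
Proof. by split; [exact: (svalP d) | ring | ring]. Qed.
Definition D2_left (d : D R) : D2 R :=
  exist _ (d : R, 0) (D2_left_subproof d).

Lemma D2_right_subproof (d : D R) :
  [/\ 0 * 0 = 0 :> R, (d : R) * d = 0 & 0 * d = 0].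
Proof. by split; [ring | exact: (svalP d) | ring]. Qed.
Definition D2_right (d : D R) : D2 R :=
  exist _ (0, d : R) (D2_right_subproof d).

Definition D2_diag_subproof (d : D R) :
  [/\ (d : R) * d = 0, (d : R) * d = 0 & (d : R) * d = 0] :=
  And3 (svalP d) (svalP d) (svalP d).
Definition D2_diag (d : D R) : D2 R :=
  exist _ (d : R, d : R) (D2_diag_subproof d).

Lemma D2_fst_subproof (p : D2 R) : (sval p).1 * (sval p).1 = 0.
Proof. by case: (svalP p). Qed.
Definition D2_fst (p : D2 R) : D R := exist _ _ (D2_fst_subproof p).

Lemma D2_snd_subproof (p : D2 R) : (sval p).2 * (sval p).2 = 0.
Proof. by case: (svalP p). Qed.
Definition D2_snd (p : D2 R) : D R := exist _ _ (D2_snd_subproof p).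

Lemma D2_add_subproof (p : D2 R) :
  ((sval p).1 + (sval p).2) * ((sval p).1 + (sval p).2) = 0.
Proof.
case: p => -[x y] /= [hx hy hxy].
have -> : (x + y) * (x + y) = x * x + y * y + (x * y + x * y) by ring.
by rewrite hx hy hxy; ring.
Qed.
Definition D2_add (p : D2 R) : D R := exist _ _ (D2_add_subproof p).

Lemma sig_eq (A : Type) (P : A -> Prop) (x y : {a | P a}) :
  sval x = sval y -> x = y.
Proof.
case: x y => x px [y py] /= e; rewrite e in px *.
by rewrite (proof_irrelevance _ px py).
Qed.

Lemma D_eq (d d' : D R) : d = d' :> R -> d = d'.
Proof. exact: sig_eq. Qed.

Lemma iso_from (A B : Type) (f : A -> B) :
  injective f -> (forall b, {a | f a = b}) -> iso f.
Proof.
move=> injf s; exists (fun b => sval (s b)); split=> x; last exact: (svalP (s x)).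
by apply: injf; exact: (svalP (s (f x))).
Qed.

Lemma sum_zero m (F : 'I_m -> R) : (forall i, F i = 0) -> \sum_(i < m) F i = 0.
Proof.
move=> F0; elim/big_ind: _ => // x y -> ->; ring.
Qed.

(* the ideal of weil_null m has zero product, so that its spectrum is D(m) *)
Definition weil_null (m : nat) : weil R.
Proof.
refine (@Weil R m (fun _ _ _ => 0) _ _ _) => //.
exists 1%N => u [|v [|//]] //= _ k; rewrite /ideal_mul.
by apply: sum_zero => i; apply: sum_zero => j; ring.
Defined.

Lemma Spec_null_mul m (r : Spec (weil_null m)) i j : sval r i * sval r j = 0.
Proof. by rewrite (svalP r) /=; apply: sum_zero => k; ring. Qed.

Lemma Spec_of_null_subproof m (r : 'I_m -> R) :
  (forall i j, r i * r j = 0) ->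
  forall i j, r i * r j = \sum_(k < m) (0 * r k).
Proof. by move=> h i j; rewrite h sum_zero // => k; ring. Qed.
Definition Spec_of_null m (r : 'I_m -> R) (h : forall i j, r i * r j = 0) :
  Spec (weil_null m) := exist _ r (Spec_of_null_subproof h).

Definition xy_coef (i j k : 'I_3) : R :=
  match val i, val j, val k with
  | 0%N, 1%N, 2%N | 1%N, 0%N, 2%N => 1
  | _, _, _ => 0
  end.

Definition sumE := (big_ord_recl, big_ord0).

Lemma ord3P (P : 'I_3 -> Prop) :
  (forall h0 h1 h2, P (@Ordinal 3 0 h0) /\ P (@Ordinal 3 1 h1) /\
     P (@Ordinal 3 2 h2)) -> forall i, P i.
Proof.
by move=> h [[|[|[|//]]] hi]; [have [] := h hi isT isT
  | have [_ []] := h isT hi isT | have [_ []] := h isT isT hi].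
Qed.

(* R[x, y]/(x^2, y^2), with basis x, y, xy of its ideal and spectrum D x D *)
Definition weil_xy : weil R.
Proof.
refine (@Weil R 3 xy_coef _ _ _).
- by elim/ord3P=> ???; do !split; elim/ord3P=> ???; do !split.
- move=> i j k l; rewrite !sumE.
  by case: i j k l => [[|[|[|//]]] ?] [[|[|[|//]]] ?] [[|[|[|//]]] ?]
    [[|[|[|//]]] ?]; rewrite /xy_coef /=; ring.
- exists 2%N => u [|v [|w [|//]]] //= _ k; rewrite /ideal_mul !sumE.
  by case: k => [[|[|[|//]]] ?]; rewrite /xy_coef /=; ring.
Defined.

Definition vec3 (x y z : R) (i : 'I_3) : R :=
  match val i with 0%N => x | 1%N => y | _ => z end.

Lemma Spec_xy_subproof (d1 d2 : D R) (r := vec3 d1 d2 (d1 * d2)) i j :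
  r i * r j = \sum_(k < 3) (xy_coef i j k * r k).
Proof.
have h1 : (d1 : R) * d1 = 0 := svalP d1.
have h2 : (d2 : R) * d2 = 0 := svalP d2.
have e1 : (d1 : R) * (d1 * d2) = 0 by rewrite (_ : _ * _ = d1 * d1 * d2); [rewrite h1|]; ring.
have e2 : (d2 : R) * (d1 * d2) = 0 by rewrite (_ : _ * _ = d1 * (d2 * d2)); [rewrite h2|]; ring.
have e3 : (d1 * d2) * (d1 * d2) = 0 by rewrite (_ : _ * _ = d1 * d1 * (d2 * d2)); [rewrite h1 h2|]; ring.
rewrite !sumE /r.
case: i j => [[|[|[|//]]] ?] [[|[|[|//]]] ?]; rewrite /xy_coef /vec3 /=;
  rewrite ?h1 ?h2 ?e1 ?e2 ?e3; try ring.
- by rewrite (_ : d1 * d2 * d1 = d1 * (d1 * d2)); [rewrite e1|]; ring.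
- by rewrite (_ : d1 * d2 * d2 = d2 * (d1 * d2)); [rewrite e2|]; ring.
Qed.
Definition Spec_xy (d1 d2 : D R) : Spec weil_xy :=
  exist _ _ (@Spec_xy_subproof d1 d2).

Lemma Spec_xyP (r : Spec weil_xy) :
  {d : D R * D R | r = Spec_xy d.1 d.2}.
Proof.
case: r => r hr.
have hx : r ord0 * r ord0 = 0 by rewrite hr !sumE /= /xy_coef /=; ring.
have hy : r (lift ord0 ord0) * r (lift ord0 ord0) = 0.
  by rewrite hr !sumE /= /xy_coef /=; ring.
exists (exist (fun d : R => d * d = 0) _ hx, exist (fun d : R => d * d = 0) _ hy); apply: sig_eq => /=.
apply: functional_extensionality; case=> [[|[|[|//]]] hi]; rewrite /vec3 /=.
- by congr r; apply: val_inj.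
- by congr r; apply: val_inj.
- rewrite /D_val /= hr !sumE /= /xy_coef /=.
  rewrite (_ : lift ord0 (lift ord0 ord0) = Ordinal hi); last exact: val_inj.
  ring.
Qed.

Definition Spec_D (d : D R) : Spec (weil_null 1) :=
  Spec_of_null (r := fun=> d : R) (fun _ _ => svalP d).

Definition D_Spec (r : Spec (weil_null 1)) : D R :=
  exist _ (sval r ord0) (Spec_null_mul r ord0 ord0).

Lemma Spec_DK (r : Spec (weil_null 1)) : Spec_D (D_Spec r) = r.
Proof.
by apply: sig_eq; apply: functional_extensionality => i; rewrite (ord1 i).
Qed.

Lemma D_SpecK (d : D R) : D_Spec (Spec_D d) = d.
Proof. exact: D_eq. Qed.

Definition vec2 (x y : R) (i : 'I_2) : R := if val i is 0%N then x else y.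

Lemma vec2_eta (v : 'I_2 -> R) : v = vec2 (v ord0) (v (lift ord0 ord0)).
Proof.
by apply: functional_extensionality; case=> [[|[|//]]] hi;
  rewrite /vec2 /=; congr v; apply: val_inj.
Qed.

Lemma Spec_D2_subproof (p : D2 R) (r := vec2 (sval p).1 (sval p).2) i j :
  r i * r j = 0.
Proof.
rewrite /r; case: p {r} => -[x y] /= [hx hy hxy].
have hyx : y * x = 0 by rewrite -hxy; ring.
by case: i j => [[|[|//]]] ? [[|[|//]] ?].
Qed.
Definition Spec_D2 (p : D2 R) : Spec (weil_null 2) :=
  Spec_of_null (@Spec_D2_subproof p).

Definition D2_Spec (r : Spec (weil_null 2)) : D2 R :=
  exist _ (sval r ord0, sval r (lift ord0 ord0))
    (And3 (Spec_null_mul r _ _) (Spec_null_mul r _ _) (Spec_null_mul r _ _)).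

Lemma Spec_D2K (r : Spec (weil_null 2)) : Spec_D2 (D2_Spec r) = r.
Proof. by apply: sig_eq; rewrite /= -vec2_eta. Qed.

Lemma D2_SpecK (p : D2 R) : D2_Spec (Spec_D2 p) = p.
Proof. by apply: sig_eq; case: p => -[]. Qed.

Context (KL : kock_lawvere R).

Lemma weil_eval_inj (W : weil R) : injective (@weil_eval R W).
Proof. by have [g [fK _]] := KL W; exact: can_inj fK. Qed.

Lemma weil_coefs (W : weil R) (f : Spec W -> R) : {w | weil_eval w = f}.
Proof. by have [g [_ gK]] := KL W; exists (g f). Qed.

Lemma D_affine_inj (a b a' b' : R) :
  (forall d : D R, a + b * d = a' + b' * d) -> a = a' /\ b = b'.
Proof.
move=> h; suff: (a, fun _ : 'I_1 => b) = (a', fun _ : 'I_1 => b').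
  by case=> -> /(f_equal (fun v => v ord0)) ->.
apply: (@weil_eval_inj (weil_null 1)); apply: functional_extensionality => r.
rewrite /weil_eval /= !sumE -(Spec_DK r) /=.
have addr0 (x : R) : x + 0 = x by ring.
by rewrite !addr0; exact: (h (D_Spec r)).
Qed.

Definition Spec0 m : Spec (weil_null m) :=
  Spec_of_null (r := fun=> 0) (fun _ _ => D0_subproof).

(* the cocone of the two axes D -> D(2) over the span D <- {0} -> D *)
Definition wedge_obj (j : option bool) : weil R :=
  weil_null (if j is Some _ then 1 else 0).

Definition wedge_leg (j : option bool) : Spec (wedge_obj j) -> Spec (weil_null 2) :=
  match j with
  | None => fun=> Spec0 2
  | Some false => fun x => Spec_D2 (D2_left (D_Spec x))
  | Some true => fun x => Spec_D2 (D2_right (D_Spec x))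
  end.

Definition wedge : cocone R.
Proof.
refine (@Cocone R (option bool) bool (fun=> None) Some wedge_obj
  (fun e _ => Spec0 1) (weil_null 2) wedge_leg _).
by case=> x; apply: sig_eq; apply: functional_extensionality;
  case=> [[|[|//]]].
Defined.

Lemma wedge_restrict_inj (M : Type) (h h' : Spec (apex wedge) -> M) :
  restrict h = restrict h' <->
  (forall d, h (Spec_D2 (D2_left d)) = h' (Spec_D2 (D2_left d))) /\
  (forall d, h (Spec_D2 (D2_right d)) = h' (Spec_D2 (D2_right d))).
Proof.
split=> [e|[e1 e2]].
  have {}e j x : sval (restrict h) j x = sval (restrict h') j x by rewrite e.
  split=> d; [have := e (Some false) (Spec_D d) | have := e (Some true) (Spec_D d)];
  by rewrite /= D_SpecK.
apply: sig_eq; apply: functional_extensionality_dep => j.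
apply: functional_extensionality; case: j => [[]|] //= x.
have -> : Spec0 2 = Spec_D2 (D2_left D0).
  by apply: sig_eq; apply: functional_extensionality; case=> [[|[|//]]].
exact: e1.
Qed.

Lemma weil_eval_left a b c d :
  weil_eval (W := weil_null 2) (a, vec2 b c) (Spec_D2 (D2_left d)) = a + b * d.
Proof. by rewrite /weil_eval !sumE /= /vec2 /=; ring. Qed.

Lemma weil_eval_right a b c d :
  weil_eval (W := weil_null 2) (a, vec2 b c) (Spec_D2 (D2_right d)) = a + c * d.
Proof. by rewrite /weil_eval !sumE /= /vec2 /=; ring. Qed.

Lemma weil_coefs1 (f : D R -> R) : {w : R * R | forall d, f d = w.1 + w.2 * d}.
Proof.
have [[a v] e] := weil_coefs (fun r => f (D_Spec r)).
exists (a, v ord0) => d; rewrite -{1}(D_SpecK d) -[f _]/((fun r => f (D_Spec r)) _) -e.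
by rewrite /weil_eval !sumE /=; ring.
Qed.

Lemma wedge_limit : to_limit wedge R.
Proof.
apply: iso_from => [h h' /wedge_restrict_inj [e1 e2]|[g hg]].
  have [[a v] eh] := weil_coefs h; have [[a' v'] eh'] := weil_coefs h'.
  move: e1 e2; rewrite -eh -eh' (vec2_eta v) (vec2_eta v') => e1 e2.
  have [] : a = a' /\ v ord0 = v' ord0.
    by apply: D_affine_inj => d; move: (e1 d); rewrite !weil_eval_left.
  have [] : a = a' /\ v (lift ord0 ord0) = v' (lift ord0 ord0).
    by apply: D_affine_inj => d; move: (e2 d); rewrite !weil_eval_right.
  by move=> -> -> _ ->.
have [[a b] e1] := weil_coefs1 (fun d => g (Some false) (Spec_D d)).
have [[a' c] e2] := weil_coefs1 (fun d => g (Some true) (Spec_D d)).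
have ea : a = a'.
  have E : Spec_D D0 = Spec0 1 by apply: sig_eq.
  have := hg false (Spec0 0); have := hg true (Spec0 0); rewrite /= -E.
  rewrite [g (Some true) _]e2 [g (Some false) _]e1 /= => <-.
  rewrite /D_val /= => e; transitivity (a + b * 0); first by ring.
  by rewrite e; ring.
exists (weil_eval (W := weil_null 2) (a, vec2 b c)).
apply: sig_eq; apply: functional_extensionality_dep => j.
apply: functional_extensionality; case: j => [[]|] /= x.
- by rewrite weil_eval_right -{2}(Spec_DK x) e2 /= ea.
- by rewrite weil_eval_left -{2}(Spec_DK x) e1.
- rewrite -(hg false x) /=.
  rewrite (_ : Spec0 1 = Spec_D D0); last exact: sig_eq.
  by rewrite [g _ _]e1 /weil_eval !sumE /D_val /=; ring.
Qed.

Lemma wedge_ext (M : Type) (X Y : D R -> M) :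
  microlinear R M -> X D0 = Y D0 ->
  {l : D2 R -> M |
    unique (fun l => forall d, l (D2_left d) = X d /\ l (D2_right d) = Y d) l}.
Proof.
move=> /(_ wedge wedge_limit) [g [fK gK]] XY0.
pose m (j : vertex wedge) : Spec (obj j) -> M :=
  match j return Spec (wedge_obj j) -> M with
  | None => fun=> X D0
  | Some false => fun x => X (D_Spec x)
  | Some true => fun x => Y (D_Spec x)
  end.
have hm : matches m.
  have E : D_Spec (Spec0 1) = D0 by exact: D_eq.
  by case=> x /=; rewrite E.
pose G : matching wedge M := exist _ m hm.
exists (fun p => g G (Spec_D2 p)); split.
  have e j x : sval (restrict (g G)) j x = m j x by rewrite gK.
  move=> d; have := e (Some false) (Spec_D d); have := e (Some true) (Spec_D d).
  by rewrite /= D_SpecK => -> ->.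
move=> l hl; apply: functional_extensionality => p.
suff -> : g G = fun r => l (D2_Spec r) by rewrite D2_SpecK.
apply: (can_inj fK); rewrite gK; apply: sig_eq => /=.
apply: functional_extensionality_dep => j; apply: functional_extensionality.
case: j => [[]|] /= x; rewrite ?D2_SpecK.
- by have [_ ->] := hl (D_Spec x).
- by have [-> _] := hl (D_Spec x).
- have [<- _] := hl D0; congr l.
  by apply: sig_eq.
Qed.

(* the cocone D x D -> D given by multiplication over the three maps D -> D x D
   sending d to (0, 0), (d, 0) and (0, d) *)
Definition mult_obj (j : bool) : weil R := if j then weil_xy else weil_null 1.

Definition mult_arrow (e : option bool) (x : Spec (weil_null 1)) : Spec weil_xy :=
  match e with
  | None => Spec_xy D0 D0
  | Some false => Spec_xy (D_Spec x) D0
  | Some true => Spec_xy D0 (D_Spec x)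
  end.

Definition D_mult (r : Spec weil_xy) : D R :=
  D_scale (sval (Spec_xyP r)).1 (sval (Spec_xyP r)).2.

Lemma D_multE d1 d2 : D_mult (Spec_xy d1 d2) = D_scale d1 d2.
Proof.
rewrite /D_mult; case: Spec_xyP => -[e1 e2] /= /(f_equal sval) /= e.
apply: D_eq; have := f_equal (fun v => v ord_max) e.
by rewrite /vec3 /=.
Qed.

Definition mult_leg (j : bool) : Spec (mult_obj j) -> Spec (weil_null 1) :=
  match j with
  | false => fun=> Spec0 1
  | true => fun x => Spec_D (D_mult x)
  end.

Definition mult : cocone R.
Proof.
refine (@Cocone R bool (option bool) (fun=> false) (fun=> true) mult_obj
  mult_arrow (weil_null 1) mult_leg _).
move=> [[]|] x; rewrite /= D_multE; apply: sig_eq;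
  apply: functional_extensionality => i /=; rewrite /D_val /=; ring.
Defined.

Lemma mult_restrict_inj (M : Type) (h h' : Spec (apex mult) -> M) :
  restrict h = restrict h' <->
  (forall d1 d2 : D R, h (Spec_D (D_scale d1 d2)) = h' (Spec_D (D_scale d1 d2))).
Proof.
split=> [e d1 d2|e].
  have {}e j x : sval (restrict h) j x = sval (restrict h') j x by rewrite e.
  by have := e true (Spec_xy d1 d2); rewrite /= D_multE.
apply: sig_eq; apply: functional_extensionality_dep => j.
apply: functional_extensionality; case: j => /= x; first exact: e.
have -> : Spec0 1 = Spec_D (D_scale D0 D0).
  apply: sig_eq; apply: functional_extensionality => i /=; rewrite /D_val /=; ring.
exact: e.
Qed.

Lemma mult_limit : to_limit mult R.
Proof.
have E0 : D_val (R := R) D0 = 0 by [].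
apply: iso_from => [h h' /mult_restrict_inj e|[g hg]].
  have [[a b] e1] := weil_coefs1 (fun d => h (Spec_D d)).
  have [[a' b'] e2] := weil_coefs1 (fun d => h' (Spec_D d)).
  have : (a, vec3 0 0 b) = (a', vec3 0 0 b').
    apply: (@weil_eval_inj weil_xy); apply: functional_extensionality => r.
    have [[d1 d2] -> /=] := Spec_xyP r.
    have E : a + b * (d1 * d2) = a' + b' * (d1 * d2).
      by have := e d1 d2; rewrite [h _]e1 [h' _]e2.
    rewrite /weil_eval !sumE /= /vec3 /=.
    transitivity (a + b * (d1 * d2)); first by ring.
    by rewrite E; ring.
  case=> ea /(f_equal (fun v => v ord_max)); rewrite /vec3 /= => eb.
  apply: functional_extensionality => x; rewrite -(Spec_DK x).
  by rewrite [h _]e1 [h' _]e2 ea eb.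
have [[a v] eg] := weil_coefs (g true).
pose x := v ord0; pose y := v (lift ord0 ord0).
pose z := v (lift ord0 (lift ord0 ord0)).
have ge d1 d2 : g true (Spec_xy d1 d2) = a + (x * d1 + y * d2 + z * (d1 * d2)).
  by rewrite -eg /weil_eval !sumE /= /vec3 /=; rewrite -/x -/y -/z; ring.
have g0 r : g false r = a.
  by have := hg None r; rewrite /= [g true _]ge E0 => <-; ring.
have x0 : x = 0.
  suff [] : a = a /\ x = 0 by [].
  apply: D_affine_inj => d; have := hg (Some false) (Spec_D d).
  rewrite g0 /= D_SpecK [g true _]ge E0 => e.
  by transitivity a; [rewrite -[RHS]e|]; ring.
have y0 : y = 0.
  suff [] : a = a /\ y = 0 by [].
  apply: D_affine_inj => d; have := hg (Some true) (Spec_D d).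
  rewrite g0 /= D_SpecK [g true _]ge E0 => e.
  by transitivity a; [rewrite -[RHS]e|]; ring.
exists (fun r => a + z * D_Spec r).
apply: sig_eq; apply: functional_extensionality_dep => j.
apply: functional_extensionality; case: j => /= r.
  have [[d1 d2] -> /=] := Spec_xyP r.
  by rewrite -[LHS]/(a + z * D_val (D_mult (Spec_xy d1 d2))) D_multE
    -[D_val (D_scale d1 d2)]/(D_val d1 * D_val d2) [g true _]ge x0 y0; ring.
by rewrite g0 /D_val /=; ring.
Qed.

Lemma mult_ext (M : Type) (tau : D R -> D R -> M) :
  microlinear R M ->
  (forall d, tau d D0 = tau D0 D0) -> (forall d, tau D0 d = tau D0 D0) ->
  {t : D R -> M | unique (fun t => forall d1 d2 : D R, t (D_scale d1 d2) = tau d1 d2) t}.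
Proof.
move=> /(_ mult mult_limit) [g [fK gK]] tau1 tau2.
pose m (j : vertex mult) : Spec (obj j) -> M :=
  match j return Spec (mult_obj j) -> M with
  | false => fun=> tau D0 D0
  | true => fun x => tau (sval (Spec_xyP x)).1 (sval (Spec_xyP x)).2
  end.
have mE d1 d2 : m true (Spec_xy d1 d2) = tau d1 d2.
  rewrite /m; case: Spec_xyP => -[e1 e2] /= /(f_equal sval) /= e.
  congr tau; apply: D_eq.
    by have := f_equal (fun v => v ord0) e; rewrite /vec3 /=.
  by have := f_equal (fun v => v (lift ord0 ord0)) e; rewrite /vec3 /=.
have hm : matches m.
  by case=> [[]|] x; rewrite [LHS]mE.
pose G : matching mult M := exist _ m hm.
exists (fun d => g G (Spec_D d)); split.
  have e j x : sval (restrict (g G)) j x = m j x by rewrite gK.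
  by move=> d1 d2; have := e true (Spec_xy d1 d2); rewrite mE /= D_multE.
move=> t ht; apply: functional_extensionality => d.
suff -> : g G = fun r => t (D_Spec r) by rewrite D_SpecK.
apply: (can_inj fK); apply/mult_restrict_inj => d1 d2; rewrite D_SpecK ht -mE.
have e j x : sval (restrict (g G)) j x = m j x by rewrite gK.
by rewrite -(e true) /= D_multE.
Qed.

End Infinitesimals.

Arguments D0 {_}.

Record lie_group (R : line) : Type := LieGroup {
  gsort :> Type;
  gone : gsort;
  gmul : gsort -> gsort -> gsort;
  ginv : gsort -> gsort;
  gmulA : associative gmul;
  gmul1 : left_id gone gmul;
  gmulV : left_inverse gone ginv gmul;
  lie_group_microlinear : microlinear R gsort
}.
Arguments gone {_ _}.
Arguments gmul {_ _}.
Arguments ginv {_ _}.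
Bind Scope grp_scope with gsort.
Notation "1" := gone : grp_scope.
Notation "x * y" := (gmul x y) : grp_scope.

Definition lie_algebra (R : line) (G : lie_group R) : Type :=
  {X : D R -> G | X D0 = 1%grp}.
Definition lie_fun (R : line) (G : lie_group R) (X : lie_algebra G) :
  D R -> G := sval X.
Coercion lie_fun : lie_algebra >-> Funclass.
Bind Scope lie_scope with lie_algebra.

Notation "- d" := (D_opp d) : D_scope.

Section LieAlgebra.
Context (R : line) (G : lie_group R).
Add Ring line_ring : (qalgebra_ring R).
Implicit Types (X Y Z : lie_algebra G) (a : R) (d : D R).
Local Open Scope grp_scope.

Lemma gmulgV (g : G) : g * ginv g = 1.
Proof.
rewrite -[g * _]gmul1 -{1}(gmulV (ginv g)) -gmulA (gmulA (ginv g)) gmulV.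
by rewrite gmul1 gmulV.
Qed.

Lemma gmulg1 (g : G) : g * 1 = g.
Proof. by rewrite -(gmulV g) gmulA gmulgV gmul1. Qed.

Lemma lie_eq X Y : X = Y :> (D R -> G) -> X = Y.
Proof. exact: sig_eq. Qed.

Lemma lie0 X : X D0 = 1.
Proof. exact: (svalP X). Qed.

Lemma lie_scale_subproof a X : X (D_scale a D0) = 1.
Proof.
rewrite -(lie0 X); congr (lie_fun X _); apply: D_eq.
by rewrite /D_val /= /D_val /=; ring.
Qed.
Definition lie_scale a X : lie_algebra G :=
  exist (fun Z : D R -> G => Z D0 = 1) (fun d => X (D_scale a d))
    (lie_scale_subproof a X).

Lemma lie_wedge X Y : {l : D2 R -> G |
  unique (fun l => forall d, l (D2_left d) = X d /\ l (D2_right d) = Y d) l}.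
Proof.
apply: (@wedge_ext R (@line_kock_lawvere R) G X Y); last by rewrite !lie0.
exact: (@lie_group_microlinear R G).
Qed.

Lemma lie_add_subproof X Y : sval (lie_wedge X Y) (D2_diag D0) = 1.
Proof.
case: lie_wedge => l [h _] /=; have [+ _] := h D0; rewrite lie0 => <-.
by congr l; apply: sig_eq.
Qed.
(* (X + Y) d = l (d, d) for the unique l : D(2) -> G equal to X and Y on the
   two axes, as in any tangent space of a microlinear space *)
Definition lie_add X Y : lie_algebra G :=
  exist (fun Z : D R -> G => Z D0 = 1)
    (fun d => sval (lie_wedge X Y) (D2_diag d)) (lie_add_subproof X Y).

Lemma lie_D2_add X (p : D2 R) : X (D2_fst p) * X (D2_snd p) = X (D2_add p).
Proof.
have [l [_ lu]] := lie_wedge X X.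
suff [h1 h2] : l = (fun p => X (D2_fst p) * X (D2_snd p)) /\
    l = (fun p => X (D2_add p)).
  by transitivity (l p); [rewrite h1 | rewrite h2].
split; apply: lu => d; last first.
  by split; congr (lie_fun X _); apply: D_eq;
    rewrite /D_val /= /D_val /=; ring.
have E1 : D2_fst (D2_left d) = d by apply: D_eq.
have E2 : D2_snd (D2_left d) = D0 by apply: D_eq.
have E3 : D2_fst (D2_right d) = D0 by apply: D_eq.
have E4 : D2_snd (D2_right d) = d by apply: D_eq.
by rewrite E1 E2 E3 E4 lie0 gmul1 gmulg1.
Qed.

Lemma lieV X d : X d * X (- d)%D = 1.
Proof.
have hd := svalP d.
have hp : [/\ (d : R) * d = 0, - d * - d = 0 & d * - d = 0]%L.
  split; first exact: (svalP d); first exact: D_opp_subproof.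
  by rewrite (_ : d * - d = - (d * d))%L; [rewrite /D_val hd|]; ring.
pose p : D2 R := exist _ ((d : R), (- d)%L) hp.
have -> : X d * X (- d)%D = X (D2_fst p) * X (D2_snd p).
  by congr gmul; congr (lie_fun X _); apply: D_eq.
rewrite lie_D2_add -(lie0 X); congr (lie_fun X _); apply: D_eq.
by rewrite /D_val /=; ring.
Qed.

Lemma lie_bracket_ext X Y : {Z : lie_algebra G | unique (fun Z =>
  forall d1 d2 : D R,
    Z (D_scale d1 d2) = X d1 * Y d2 * X (- d1)%D * Y (- d2)%D) Z}.
Proof.
have N0 : (- D0 = D0 :> D R)%D by apply: D_eq; rewrite /D_val /=; ring.
have [||t [ht tu]] := mult_ext (@line_kock_lawvere R)
  (tau := fun d1 d2 => X d1 * Y d2 * X (- d1)%D * Y (- d2)%D)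
  (@lie_group_microlinear R G).
- by move=> d; rewrite N0 !lie0 !gmulg1 lieV.
- by move=> d; rewrite N0 !lie0 !(gmul1, gmulg1) lieV.
have t0 : t D0 = 1.
  have -> : D0 = D_scale (D0 : D R) D0.
    by apply: D_eq; rewrite /D_val /= /D_val /=; ring.
  by rewrite ht N0 !lie0 !gmul1.
exists (exist _ t t0); split=> // Z hZ.
by apply: lie_eq; exact: tu.
Qed.

Definition lie_bracket X Y : lie_algebra G := sval (lie_bracket_ext X Y).

End LieAlgebra.

Notation "X + Y" := (lie_add X Y) : lie_scope.
Notation "a *: X" := (lie_scale a%L X) : lie_scope.
Notation "[ X , Y ]" := (lie_bracket X Y) : lie_scope.

Definition evolution (R : line) (G : lie_group R)
    (zeta : R -> lie_algebra G) (gamma : R -> G) : Prop :=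
  gamma 0%L = 1%grp /\
  forall (t : R) (d : D R), gamma (t + d)%L = (gamma t * zeta t d)%grp.

Definition regular (R : line) (G : lie_group R) : Type :=
  forall zeta : R -> lie_algebra G, {gamma : R -> G | unique (evolution zeta) gamma}.

Definition exp (R : line) (G : lie_group R) (reg : regular G)
    (X : lie_algebra G) : G := sval (reg (fun=> X)) 1%L.

(* Main.v *)
From mathcomp Require Import all_boot.
From Stdlib Require Import Ring.
Require Import Defs.

(** Write delta = d1 + d2, so that delta^2 / 2 = d1 d2.  The point is that the
    exponential of delta X + (delta^2 / 2) Y only ever evaluates X and Y on D,
    where they are already given:
      exp (delta X + (delta^2 / 2) Y) = X(d1) X(d2) Y(d1 d2)
    ([exp_second_order]).  Indeed, if c is the one-parameter curve of X, then
    t |-> c(t delta) Y(t d1 d2) solves the equation defining the left-hand side,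
    the two factors commuting infinitesimally because delta (d1 d2) = 0; at
    t = 1 the equation of c gives c(d1 + d2) = X(d1) X(d2).

    The theorem then becomes an identity in the group,
      X1(d1) X1(d2) X2(e) Y1(d1) Y1(d2) Y2(e)
        = X1(d1) Y1(d1) X1(d2) Y1(d2) X2(e) Y2(e) [X1, Y1](e)   with e = d1 d2,
    since (X + Y)(d) = X(d) Y(d) ([lie_addE]).  Values at e commute with values
    at d1, d2 and e, because e annihilates these ([lie_comm]).  So the two sides
    differ only by the exchange of X1(d2) and Y1(d1), which costs exactly
    [X1, Y1](e) ([lie_swap]). *)

Section SecondOrder.
Context (R : line) (G : lie_group R).
Add Ring line_ring : (qalgebra_ring R).
Implicit Types (X Y : lie_algebra G) (d a b : D R).
Local Open Scope grp_scope.

Lemma D_scaleE (a : R) d : D_val (D_scale a d) = (a * d)%L.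
Proof. by []. Qed.

Lemma D_scaleC a b : D_scale a b = D_scale b a.
Proof. by apply: D_eq; rewrite !D_scaleE; ring. Qed.

Lemma D_scale_mulr (x : R) a : (D_scale x a * a = 0 :> R)%L.
Proof.
have h : (a * a = 0 :> R)%L := svalP a.
by transitivity (x * (a * a) : R)%L; [rewrite D_scaleE | rewrite h]; ring.
Qed.

Lemma lie_congr X d d' : d = d' :> R -> X d = X d'.
Proof. by move=> e; congr (lie_fun X _); exact: D_eq. Qed.

(** On D(2) the products of X and Y in either order restrict to X and Y on the
    axes, so microlinearity identifies both with the map that defines X + Y. *)
Lemma lie_wedgeE X Y (p : D2 R) :
  sval (lie_wedge X Y) p = X (D2_fst p) * Y (D2_snd p) /\
  sval (lie_wedge X Y) p = Y (D2_snd p) * X (D2_fst p).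
Proof.
case: lie_wedge => l [_ lu] /=.
have E1 d : X (D2_fst (D2_left d)) = X d by exact: lie_congr.
have E2 d : Y (D2_snd (D2_left d)) = 1 by rewrite -(lie0 Y); exact: lie_congr.
have E3 d : X (D2_fst (D2_right d)) = 1 by rewrite -(lie0 X); exact: lie_congr.
have E4 d : Y (D2_snd (D2_right d)) = Y d by exact: lie_congr.
split.
  rewrite (lu (fun p => X (D2_fst p) * Y (D2_snd p))) // => d.
  by rewrite E1 E2 E3 E4 gmul1 gmulg1.
rewrite (lu (fun p => Y (D2_snd p) * X (D2_fst p))) // => d.
by rewrite E1 E2 E3 E4 gmul1 gmulg1.
Qed.

Lemma lie_addE X Y d : (X + Y)%lie d = X d * Y d.
Proof.
have [e _] := lie_wedgeE X Y (D2_diag d).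
rewrite [LHS]e; congr (_ * _); exact: lie_congr.
Qed.

Definition D2_pair a b (h : (a * b)%L = 0%L) : D2 R :=
  exist (fun p : R * R => [/\ (p.1 * p.1)%L = 0%L, (p.2 * p.2)%L = 0%L
                            & (p.1 * p.2)%L = 0%L])
    ((a : R), (b : R)) (And3 (svalP a) (svalP b) h).

Lemma lie_comm X Y a b : (a * b)%L = 0%L -> X a * Y b = Y b * X a.
Proof.
move=> h; have [e1 e2] := lie_wedgeE X Y (D2_pair a b h).
rewrite (lie_congr X a (D2_fst (D2_pair a b h))) //.
by rewrite (lie_congr Y b (D2_snd (D2_pair a b h))) // -e1 -e2.
Qed.

Lemma lie_add_orth X a b c :
  (a * b)%L = 0%L -> D_val c = (a + b)%L -> X c = X a * X b.
Proof.
move=> h e; rewrite (lie_congr X a (D2_fst (D2_pair a b h))) //.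
rewrite (lie_congr X b (D2_snd (D2_pair a b h))) // lie_D2_add.
exact: lie_congr.
Qed.

Lemma lieVl X d : X (- d)%D * X d = 1.
Proof.
rewrite -(lieV X (- d)%D); congr (_ * _); apply: lie_congr.
by rewrite /D_val /= /D_val /=; ring.
Qed.

(** The bracket at ab is the group commutator X(a) Y(b) X(-a) Y(-b), in which
    X(-a) and Y(-b) invert X(a) and Y(b). *)
Lemma lie_swap X Y a b :
  X a * Y b = [X, Y]%lie (D_scale a b) * (Y b * X a).
Proof.
rewrite /lie_bracket; case: lie_bracket_ext => Z [hZ _] /=.
rewrite hZ -gmulA (gmulA (Y (- b)%D)) lieVl gmul1.
by rewrite -gmulA lieVl gmulg1.
Qed.

Lemma one_half2 : (one_half + one_half = 1 :> R)%L.
Proof. by rewrite /one_half -of_ratD -(of_rat1 R); congr of_rat. Qed.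

Lemma half_square (d1 d2 : D R) :
  (one_half * (d1 + d2) ^+ 2 = d1 * d2 :> R)%L.
Proof.
have h1 : (d1 * d1 = 0 :> R)%L := svalP d1.
have h2 : (d2 * d2 = 0 :> R)%L := svalP d2.
rewrite /pow /=.
transitivity ((one_half + one_half) * (d1 * d2)
              + one_half * (d1 * d1 + d2 * d2) : R)%L; first by ring.
by rewrite h1 h2 one_half2; ring.
Qed.

(** With delta = d1 + d2 and c the one-parameter curve of X, the curve
    t |-> c(t delta) Y(t d1 d2) satisfies the equation that characterizes the
    exponential on the left: the increment d delta of t delta is an
    element of D, so c contributes X(d delta), and moving this factor past
    Y(t d1 d2) is free because delta d1 d2 = 0. *)
Lemma exp_second_order (reg : regular G) (d1 d2 : D R) X Y :
  exp reg ((d1 + d2) *: X + (one_half * (d1 + d2) ^+ 2) *: Y)%lie =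
  X d1 * X d2 * Y (D_scale d1 d2).
Proof.
rewrite half_square /exp; case: (reg (fun=> _)) => g [_ gu] /=.
have [c [[c0 cS] _]] := reg (fun=> X).
have h1 : (d1 * d1 = 0 :> R)%L := svalP d1.
have h2 : (d2 * d2 = 0 :> R)%L := svalP d2.
pose e := D_scale d1 d2.
rewrite (gu (fun t => c (t * (d1 + d2))%L * Y (D_scale t e))).
  (* at t = 1, two steps of the equation of c lead from 0 to d1 + d2 *)
  rewrite (_ : 1 * (d1 + d2) = 0 + d1 + d2)%L; last by ring.
  rewrite !cS c0 gmul1; congr (_ * _); apply: lie_congr.
  by rewrite /e !D_scaleE; ring.
split.
  rewrite (_ : 0 * (d1 + d2) = 0)%L; last by ring.
  rewrite c0 gmul1 -(lie0 Y); apply: lie_congr.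
  by rewrite D_scaleE -[RHS]/(0%L : R); ring.
move=> t d.
rewrite lie_addE.
have -> : ((t + d) * (d1 + d2) = t * (d1 + d2) + D_scale (d1 + d2) d)%L.
  by rewrite D_scaleE; ring.
rewrite cS (lie_add_orth Y (D_scale t e) (D_scale (d1 * d2)%L d)).
- rewrite -!gmulA; congr (_ * _); rewrite !gmulA; congr (_ * _).
  apply: lie_comm; rewrite /e !D_scaleE.
  transitivity (d * t * (d1 * d1 * d2 + d1 * (d2 * d2)) : R)%L; first by ring.
  by rewrite h1 h2; ring.
- rewrite /e !D_scaleE.
  transitivity (t * d * (d1 * d1) * (d2 * d2) : R)%L; first by ring.
  by rewrite h1; ring.
- by rewrite /e !D_scaleE; ring.
Qed.

End SecondOrder.

Arguments lie_comm {R G}.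

Theorem theorem13 (R : line) (G : lie_group R) (reg : regular G)
    (d1 d2 : D R) (X1 X2 Y1 Y2 : lie_algebra G) :
  (exp reg ((d1 + d2) *: X1 + (one_half * (d1 + d2) ^+ 2) *: X2)%lie *
   exp reg ((d1 + d2) *: Y1 + (one_half * (d1 + d2) ^+ 2) *: Y2)%lie)%grp =
  exp reg ((d1 + d2) *: (X1 + Y1) +
           (one_half * (d1 + d2) ^+ 2) *: (X2 + Y2 + [X1, Y1]))%lie.
Proof.
rewrite !exp_second_order !lie_addE.
set e := D_scale d1 d2.
have e1 : (e * d1 = 0)%L by rewrite /e D_scaleC; exact: D_scale_mulr.
have e2 : (e * d2 = 0)%L by exact: D_scale_mulr.
have ee : (e * e = 0)%L := svalP e.
have sw : (X1 d2 * Y1 d1 = [X1, Y1]%lie e * (Y1 d1 * X1 d2))%grp.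
  by rewrite lie_swap D_scaleC.
have X2Y1 : (X2 e * (Y1 d1 * Y1 d2) = Y1 d1 * Y1 d2 * X2 e)%grp.
  by rewrite gmulA (lie_comm X2 Y1 e d1) // -gmulA (lie_comm X2 Y1 e d2) // gmulA.
set Z := [X1, Y1]%lie in sw *.
have ZC : (Z e * (Y1 d1 * X1 d2 * Y1 d2 * X2 e * Y2 e) =
           Y1 d1 * X1 d2 * Y1 d2 * X2 e * Y2 e * Z e)%grp.
  rewrite !gmulA (lie_comm Z Y1 e d1) // -!(gmulA (Y1 d1)); congr gmul.
  rewrite (lie_comm Z X1 e d2) // -!(gmulA (X1 d2)); congr gmul.
  rewrite (lie_comm Z Y1 e d2) // -!(gmulA (Y1 d2)); congr gmul.
  rewrite (lie_comm Z X2 e e) // -!(gmulA (X2 e)); congr gmul.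
  exact: lie_comm.
transitivity (X1 d1 * (X1 d2 * Y1 d1) * Y1 d2 * X2 e * Y2 e)%grp.
  by rewrite -!gmulA; do 2 congr gmul; rewrite !gmulA -(gmulA (X2 e)) X2Y1.
rewrite sw -!(gmulA (X1 d1)); congr gmul.
by rewrite -!(gmulA (Z e)) ZC -!gmulA.
Qed.
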